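(* Let $d\ge1$ and let $X$ be a $\mathbb{Z}^d$-subshift. If $X$ is weakly mixing and $\overline{\mathbb{Z}}$ is a weak factor of $X$, then $X\notin\mathcal{L}^1$.
   Context: **Subshifts.** For $d\ge 1$ and a finite alphabet $A$, $A^{\mathbb{Z}^d}$ carries the product topology and the shift action $(\sigma^p x)(q)=x(p+q)$. A $\mathbb{Z}^d$-subshift is a closed set $X\subseteq A^{\mathbb{Z}^d}$ with $\sigma^p(X)=X$ for all $p\in\mathbb{Z}^d$. **Weak mixing.** A pattern $\pi\in A^F$ ($F\subseteq\mathbb{Z}^d$ finite) appears at position $p$ in $x$ if $x(p+q)=\pi(q)$ for all $q\in F$; it is valid if it appears in some $x\in X$. $X$ is transitive if for all valid finite patterns $\pi,\pi'$ there is $x\in X$ in which both appear (at some positions). $X$ is weakly mixing if $X\times X$ (a subshift over the product alphabet) is transitive. **Weak factor.** A $\mathbb{Z}^e$-subshift $Y$ is a weak factor of a $\mathbb{Z}^d$-subshift $X$ if there exist a continuous surjective $f:X\to Y$ and a group homomorphism $\varphi:\mathbb{Z}^e\to\mathbb{Z}^d$ with $\sigma^p\circ f=f\circ\sigma^{\varphi(p)}$ for all $p\in\mathbb{Z}^e$. **$\overline{\mathbb{Z}}$.** $\overline{\mathbb{Z}}=\mathbb{Z}\cup\{-\infty,+\infty\}$ with the topology generated by the sets $\{n\}$, $[n,+\infty]$, $[-\infty,n]$ ($n\in\mathbb{Z}$) and the $\mathbb{Z}$-action $p\cdot n=p+n$ for $n\in\mathbb{Z}$, $p\cdot(\pm\infty)=\pm\infty$.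 It is identified with the conjugate $\mathbb{Z}$-subshift $X_{\overline{\mathbb{Z}}}=\{x\in\{0,1\}^{\mathbb{Z}}:\ \forall i,\ x(i)\le x(i+1)\}$, where $n$ corresponds to the configuration equal to $0$ at positions $p<-n$ and to $1$ at positions $p\ge -n$. **The class $\mathcal{L}^1$.** Let $E,F$ be countable sets and $A,B$ finite alphabets. For a continuous $f:A^E\to B^F$, a position $q\in F$ is determined by $R\subseteq E$ if any $x,y\in A^E$ that coincide on $R$ satisfy $f(x)(q)=f(y)(q)$. $f$ is $r$-narrow ($r\in\mathbb{N}$) if each $q\in F$ is determined by a set of size at most $r$, and narrow if it is $r$-narrow for some $r$. A compact set $X\subseteq\Sigma^F$ ($\Sigma$ finite, $F$ countable) belongs to $\mathcal{L}^1$ if $X=\bigcup_{n\in\mathbb{N}}\mathrm{im}(f_n)$ where each $f_n:A_n^{\mathbb{N}}\to X$ is $r_n$-narrow for some finite alphabet $A_n$ and some $r_n\in\mathbb{N}$. *)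

(* Defs.v *)
From HB Require Import structures.
From mathcomp Require Import all_boot all_order all_algebra finmap.
From mathcomp Require Import all_classical topology.

Set Implicit Arguments.
Unset Strict Implicit.
Unset Printing Implicit Defensive.

Import GRing.Theory.

Local Open Scope classical_set_scope.
Local Open Scope ring_scope.

(* The space A^E: product topology over the discrete alphabet A. *)
Notation config E A := {ptws E -> discrete_topology A}.

(* Everything is stated for an abelian group G of positions; it is used for
   G = 'rV[int]_d (that is, Z^d) and for G = int. *)
Definition shift (G : zmodType) (A : finType) (p : G) (x : config G A) :
  config G A := fun q => x (p + q).

Definition is_subshift (G : zmodType) (A : finType) (X : set (config G A)) :
  Prop := closed X /\ forall p : G, shift p @` X = X.

(* A pattern is a finite map: its domain is a finite set of positions. *)
Definition appears_at (G : zmodType) (A : finType) (pi : {fmap G -> A})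
  (p : G) (x : config G A) : Prop :=
  forall q : domf pi, x (p + val q) = pi q.

Definition appears (G : zmodType) (A : finType) (pi : {fmap G -> A})
  (x : config G A) : Prop := exists p : G, appears_at pi p x.

Definition valid (G : zmodType) (A : finType) (X : set (config G A))
  (pi : {fmap G -> A}) : Prop := exists2 x, X x & appears pi x.

Definition transitive_shift (G : zmodType) (A : finType)
  (X : set (config G A)) : Prop :=
  forall pi pi' : {fmap G -> A}, valid X pi -> valid X pi' ->
    exists x, [/\ X x, appears pi x & appears pi' x].

(* X x Y as a set of configurations over the product alphabet. *)
Definition prod_shift (G : zmodType) (A B : finType) (X : set (config G A))
  (Y : set (config G B)) : set (config G (A * B)%type) :=
  [set z | X (fun p => (z p).1) /\ Y (fun p => (z p).2)].

Definition weakly_mixing (G : zmodType) (A : finType)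
  (X : set (config G A)) : Prop := transitive_shift (prod_shift X X).

(* Only the restriction of f to X matters: it is continuous for the subspace
   topology of X, has image Y, and is equivariant along phi. *)
Definition weak_factor (G H : zmodType) (A B : finType)
  (X : set (config G A)) (Y : set (config H B)) : Prop :=
  exists (f : config G A -> config H B) (phi : {additive H -> G}),
    [/\ {within X, continuous f},
        f @` X = Y &
        forall (p : H) x, X x -> shift p (f x) = f (shift (phi p) x)].

(* The two-point compactification of Z as a subshift: n is the configuration
   equal to 0 before -n and to 1 from -n on; -oo and +oo are the constant
   configurations 0 and 1. *)
Definition Zbar : set (config int bool) :=
  [set x | forall i : int, (x i <= x (i + 1)%R)%N].

Definition determined_by (E F : countType) (A B : finType)
  (f : config E A -> config F B) (q : F) (R : set E) : Prop :=
  forall x y : config E A, (forall i, R i -> x i = y i) -> f x q = f y q.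

Definition narrow (E F : countType) (A B : finType) (r : nat)
  (f : config E A -> config F B) : Prop :=
  forall q : F, exists2 R : set E, (R #<= `I_r)%card & determined_by f q R.

Definition in_L1 (F : countType) (S : finType) (X : set (config F S)) : Prop :=
  compact X /\
  exists (A : nat -> finType) (r : nat -> nat)
         (f : forall n, config nat (A n) -> config F S),
    (forall n, continuous (f n) /\ narrow (r n) (f n)) /\
    X = \bigcup_n range (f n).

(* Main.v *)
(* Suppose X is the union of the images of narrow maps F_n. By Baire's theorem some
   image F_n(A_n^N) contains a nonempty relatively open subset U of X. For a shift
   v, compose F_n with v and with the weak factor map f onto Zbar, and look at the
   cells 0, 1, 2, ... of the result: they form a nondecreasing sequence of Boolean
   functions, each depending on boundedly many coordinates, the bound not depending
   on v. The number of distinct functions in such a sequence is bounded (fix the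
   coordinates read by the first satisfiable function g: any later function that
   does not share a coordinate with g is identically true). On the other hand,
   weak mixing gives, for every m, a single v that sends points of U into each of
   the open sets f^-1{-1}, ..., f^-1{-m}, which forces m jumps in the sequence. *)

Require Import Defs.
From HB Require Import structures.
From mathcomp Require Import all_boot all_order all_algebra finmap.
From mathcomp Require Import all_classical topology.
From mathcomp Require Import zify.

Set Implicit Arguments.
Unset Strict Implicit.
Unset Printing Implicit Defensive.

Import GRing.Theory.

(** * Monotone sequences of Boolean functions of few coordinates *)

Section Juntas.
Variables (E : eqType) (A : finType).
Implicit Types (g : (E -> A) -> bool) (b : nat -> (E -> A) -> bool).
Implicit Types (s t : seq E).

Definition junta g s := forall x y, {in s, x =1 y} -> g x = g y.

Lemma juntaS g s t : {subset s <= t} -> junta g s -> junta g t.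
Proof. by move=> st gs x y xy; apply: gs => i /st /xy. Qed.

Definition chain b := forall j x, b j x -> b j.+1 x.

Lemma chain_le b i j x : chain b -> i <= j -> b i x -> b j x.
Proof.
move=> cb ij bi; rewrite -(subnK ij) addnC.
by elim: (j - i) => [|k /cb]; rewrite ?addn0 ?addnS.
Qed.

(** For a chain, this is one less than the number of distinct functions among [b 0], ..., [b n]. *)
Definition jumps b n := \sum_(j < n) `[< exists x, b j x != b j.+1 x >].

Definition put (k : E) (a : A) (x : E -> A) : E -> A :=
  fun i => if i == k then a else x i.

(** A jump at [j] witnessed by [x] survives fixing coordinate [k] to the value [x k]. *)
Lemma jumps_put b n k : jumps b n <= \sum_(a : A) jumps (fun j => b j \o put k a) n.
Proof.
rewrite exchange_big leq_sum //= => j _.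
case: asboolP => // -[x bx]; rewrite (bigD1 (x k)) //= asboolT //.
exists x; rewrite (_ : put k (x k) x = x) //.
by apply/funext => i; rewrite /put; case: eqP => // ->.
Qed.

(** The coordinates in [s] are fixed one at a time, each at the cost of a factor [#|A|]. *)
Lemma jumps_fix r m n :
  (forall b, chain b -> (forall j, exists2 t, size t <= r & junta (b j) t) ->
    jumps b n <= m) ->
  forall s b, chain b ->
    (forall j, exists2 t, size t <= r & junta (b j) (s ++ t)) ->
    jumps b n <= #|A| ^ size s * m.
Proof.
move=> bm; elim=> [|k s IH] b cb bj; first by rewrite mul1n bm.
apply: leq_trans (jumps_put b n k) _.
rewrite expnS -mulnA -sum_nat_const; apply: leq_sum => a _.
apply: IH => [j x|j]; first exact: cb.
have [t tr bt] := bj j; exists t => // x y xy; apply: bt => i.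
rewrite inE /put; case: eqP => //= _; exact: xy.
Qed.

(* If [s] and [t] are disjoint, [y] can be overwritten by [x] on [s] without
   changing [b j y]; this makes [b i] true, hence also [b j]. *)
Lemma chain_junta_dichotomy b s i j t x :
  chain b -> i <= j -> junta (b i) s -> b i x -> junta (b j) t ->
  has (mem s) t \/ forall y, b j y.
Proof.
move=> cb ij bs bx bt; case: (boolP (has _ _)) => [|st]; [by left|right=> y].
pose z k := if k \in s then x k else y k.
have bz : b i z by rewrite (bs z x) // => k ks; rewrite /z ks.
rewrite (bt y z) ?(chain_le cb ij) // => k kt.
by rewrite /z; case: ifP => // ks; case/hasP: st; exists k.
Qed.

Lemma jumps_constant b n : chain b -> (forall j, junta (b j) [::]) -> jumps b n <= 1.
Proof.
move=> cb b0; have [[x _]|nx] := pselect (exists x : E -> A, True); last first.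
  rewrite /jumps big1 // => j _; case: asboolP => // -[x _].
  by case: nx; exists x.
(* By this invariant, a jump at [n], which forces [b n x] to be false, has no jump before it. *)
suff : jumps b n + b 0 x <= b n x by case: (b n x) (b 0 x) => [] []; lia.
elim: n => [|n IH]; first by rewrite /jumps big_ord0.
rewrite /jumps big_ord_recr /=; move: IH; rewrite -/(jumps b n).
have := @cb n x; case: asboolP => [[y]|_]; last first.
  rewrite addn0 => bnx le; apply: leq_trans le _.
  by case: (b n x) bnx => // ->.
rewrite (b0 n y x) // (b0 n.+1 y x) //.
case: (b n x) (b n.+1 x) => [] [] // _ cx; first by move: cx => /(_ isT).
by rewrite addnAC addn1.
Qed.

(* Induction on [r]: fixing the coordinates read by the first [b i] that is not
   identically false leaves a chain of juntas of size [r]. *)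
Lemma jumps_bounded r : exists m, forall b n, chain b ->
  (forall j, exists2 s, size s <= r & junta (b j) s) -> jumps b n <= m.
Proof.
elim: r => [|r [m IH]].
  exists 1 => b n cb bj; apply: jumps_constant => // j.
  by have [[|//] _] := bj j.
(* The exponent bounds [size s] below; the base [#|A|.+1] keeps the power monotone even for empty
   [A]. *)
exists (#|A|.+1 ^ r.+1 * m) => b n cb bj.
have [ex|nex] := pselect (exists i, `[< exists x, b i x >]); last first.
  rewrite /jumps big1 // => j _; case: asboolP => // -[x].
  have nb i : b i x = false.
    by apply/negP => bx; apply: nex; exists i; apply/asboolP; exists x.
  by rewrite !nb.
case: (ex_minnP ex) => i /asboolP[x bx] imin.
have [s sr bs] := bj i.
apply: (@leq_trans (#|A| ^ size s * m)); last first.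
  rewrite leq_mul2r; apply/orP; right.
  apply: (@leq_trans (#|A|.+1 ^ size s)).
    by case: (size s) => // k; rewrite leq_exp2r.
  exact: leq_pexp2l.
apply: (@jumps_fix r) => // [b' cb' bj'|j]; first exact: IH.
have [ij|ji] := leqP i j; last first.
  have nb y : b j y = false.
    apply/negP => bjy; suff : i <= j by rewrite leqNgt ji.
    by apply: imin; apply/asboolP; exists y.
  by exists [::] => // y z _; rewrite !nb.
have [t tr bt] := bj j.
have [/hasP[k kt ks]|bT] := chain_junta_dichotomy cb ij bs bx bt; last first.
  by exists [::] => // y z _; rewrite !bT.
(* The coordinate [k] of [t] is already fixed through [s], so at most [r] others remain. *)
exists (rem k t); first by rewrite size_rem //; case: (size t) tr.
apply: juntaS bt => l lt; rewrite mem_cat.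
have [->|lk] := eqVneq l k; first by rewrite (ks : k \in s).
have := perm_mem (perm_to_rem kt) l; rewrite lt inE (negPf lk) /= => <-.
by rewrite orbT.
Qed.

End Juntas.

Local Open Scope classical_set_scope.
Local Open Scope ring_scope.

(** * Cylinders and the topology of configuration spaces *)

Section Cylinders.
Variables (E : choiceType) (A : finType).
Implicit Types (x y : config E A) (s : seq E).

Definition cylinder x s : set (config E A) := [set y | forall q, q \in s -> y q = x q].

Lemma cylinder_cat x s t y :
  cylinder x (s ++ t) y <-> cylinder x s y /\ cylinder x t y.
Proof.
split=> [xy|[xsy xty] q]; last by rewrite mem_cat => /orP[/xsy|/xty].
by split=> q qs; apply: xy; rewrite mem_cat qs ?orbT.
Qed.

Lemma cylinder_nbhs x s : nbhs x (cylinder x s).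
Proof.
elim: s => [|k s IH]; first by apply: filterS filterT.
have : nbhs x (@proj E (fun=> discrete_topology A) k @^-1` [set x k]).
  exact: (@proj_continuous E (fun=> discrete_topology A) k x).
move: IH; apply: filterS2 => y ys yk q; rewrite inE => /orP[/eqP ->|/ys] //.
Qed.

Lemma nbhs_cylinder x (U : set (config E A)) :
  nbhs x U -> exists s, cylinder x s `<=` U.
Proof.
pose F := filter_from [set: seq E] (cylinder x).
have FF : Filter F.
  apply: filter_from_filter; first by exists [::].
  by move=> s t _ _; exists (s ++ t) => // y /cylinder_cat.
suff Fx : F --> x by move=> /Fx [s _ sU]; exists s.
apply/cvg_sup => k; apply/cvg_image.
  by rewrite eqEsubset; split=> // a _; exists (fun=> a).
move=> W /= Wxk; exists (@proj E (fun=> discrete_topology A) k @^-1` W).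
  exists [:: k] => // y /(_ k (mem_head _ _)) yk /=; rewrite /proj yk.
  exact: nbhs_singleton Wxk.
rewrite eqEsubset; split=> [a [y Wy <-]//|a Wa].
by exists (fun=> a).
Qed.

Lemma compact_config : compact [set: config E A].
Proof.
have := @tychonoff E (fun=> discrete_topology A) (fun=> setT).
rewrite (_ : [set _ | _] = setT); last by rewrite eqEsubset.
apply=> k; apply: finite_compact; exact: (@finite_finset A setT).
Qed.

Lemma hausdorff_config : hausdorff_space (config E A).
Proof.
apply: (@hausdorff_product E (fun=> discrete_topology A)) => k.
exact: discrete_hausdorff.
Qed.

End Cylinders.

(** * Baire's theorem and uniform continuity on compact sets *)

Section CompactSets.
Variables (E : choiceType) (A : finType) (X : set (config E A)).
Hypothesis compactX : compact X.

(** Otherwise nested cylinders can be chosen, step [n] avoiding [C n]; by compactness they share a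
    point of [X], which lies in no [C n]. *)
Lemma compact_baire (C : nat -> set (config E A)) x0 :
  X x0 -> (forall n, closed (C n)) -> X `<=` \bigcup_n C n ->
  exists n x s, X x /\ X `&` cylinder x s `<=` C n.
Proof.
move=> Xx0 Cclosed XC; apply: contrapT => nC.
have step n x s : X x -> exists y t,
    [/\ X y, cylinder y t `<=` cylinder x s & cylinder y t `<=` ~` C n].
  move=> Xx; have [y [[Xy xy] nCy]] : (X `&` cylinder x s) `\` C n !=set0.
    apply/set0P/eqP; rewrite setD_eq0 => sub; apply: nC; exists n, x, s; split => //.
  have [t tC] : exists t, cylinder y t `<=` ~` C n.
    by apply/nbhs_cylinder/open_nbhs_nbhs; split; first exact: closed_openC.
  exists y, (s ++ t); split=> // z /cylinder_cat[ys yt]; last exact: tC.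
  by move=> q qs; rewrite ys // xy.
pose T := (config E A * seq E)%type.
have /choice[next nextP] : forall p : nat * T, exists p' : T, X p.2.1 ->
    [/\ X p'.1, cylinder p'.1 p'.2 `<=` cylinder p.2.1 p.2.2
      & cylinder p'.1 p'.2 `<=` ~` C p.1].
  move=> [n [x s]]; have [Xx|nXx] := pselect (X x); last by exists (x, s).
  by have [y [t yt]] := step n x s Xx; exists (y, t).
pose u := fix u n := if n is m.+1 then next (m, u m) else (x0, [::]).
pose D n := X `&` cylinder (u n).1 (u n).2.
have Xu n : X (u n).1 by elim: n => [//|n /(nextP (n, u n))[]].
have uS n := nextP (n, u n) (Xu n).
have Dle i j : (i <= j)%N -> D j `<=` D i.
  move=> /subnK <-; elim: (j - i)%N => // k IH x [Xx].
  by rewrite addSn => /(let: And3 _ h _ := uS _ in h x) kx; apply: IH; split.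
pose F := filter_from [set: nat] D.
have FF : ProperFilter F.
  apply: filter_from_proper => [|n _]; last by exists (u n).1; split.
  apply: filter_from_filter; first by exists 0%N.
  move=> i j _ _; exists (maxn i j) => // x Dx.
  by split; apply: Dle Dx; rewrite ?leq_maxl ?leq_maxr.
have FX : F X by exists 0%N => // x [].
have [x [Xx clx]] := compactX FF FX.
have [n _ Cnx] := XC x Xx.
have Dx : cylinder (u n.+1).1 (u n.+1).2 x.
  have [y [[_ uy] xy]] : D n.+1 `&` cylinder x (u n.+1).2 !=set0.
    by apply: clx; [exists n.+1 | exact: cylinder_nbhs].
  by move=> q qu; rewrite -xy // uy.
by have [_ _ /(_ _ Dx)] := uS n.
Qed.

(** If every window failed, the failing points would cluster at some [x] in [X], against the local
    window at [x]. *)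
Lemma uniform_window (B : finType) (h : config E A -> B) :
  (forall x, X x -> exists s, forall y, X y -> cylinder x s y -> h y = h x) ->
  exists s, forall x y, X x -> X y -> cylinder x s y -> h x = h y.
Proof.
move=> hX; apply: contrapT => nh.
pose D s := [set x | X x /\ exists y, [/\ X y, cylinder x s y & h x <> h y]].
pose F := filter_from [set: seq E] D.
have FF : ProperFilter F.
  apply: filter_from_proper => [|s _].
    apply: filter_from_filter; first by exists [::].
    move=> s t _ _; exists (s ++ t) => // x [Xx [y [Xy /cylinder_cat[xs xt] hxy]]].
    by split; split=> //; exists y.
  apply: contrapT => nD; apply: nh; exists s => x y Xx Xy xy.
  by apply: contrapT => hxy; apply: nD; exists x; split=> //; exists y.
have FX : F X by exists [::] => // x [].
have [x [Xx clx]] := compactX FF FX.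
have [s hs] := hX x Xx.
have [y [[Xy [z [Xz yz hyz]]] xy]] : D s `&` cylinder x s !=set0.
  by apply: clx; [exists s | exact: cylinder_nbhs].
by apply: hyz; rewrite (hs y) // (hs z) // => q qs; rewrite yz // xy.
Qed.

End CompactSets.

(** * Weak mixing in terms of cylinders *)

Section Patterns.
Variables (G : zmodType) (A : finType).

Definition pattern (x : config G A) (s : seq G) : {fmap G -> A} :=
  [fmap q : [fset q in s]%fset => x (val q)].

Lemma appears_pattern x s p y :
  appears_at (pattern x s) p y <-> cylinder x s (shift p y).
Proof.
split=> [xy q qs|xy q]; last first.
  by rewrite ffunE -xy //; have := valP q; rewrite !inE.
have qs' : q \in [fset q in s]%fset by rewrite !inE.
by have := xy [` qs']%fset; rewrite ffunE.
Qed.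

End Patterns.

Section WeakMixing.
Variables (G : zmodType) (A : finType) (X : set (config G A)).
Hypothesis shiftX : forall p : G, shift p @` X = X.
Hypothesis mixX : weakly_mixing X.

Lemma shift_in p x : X x -> X (shift p x).
Proof. by rewrite -{2}(shiftX p) => Xx; exists x. Qed.

Lemma shiftD p q (x : config G A) : shift p (shift q x) = shift (q + p) x.
Proof. by apply/funext => i; rewrite /shift addrA. Qed.

Lemma shift_cylinder p s (x y : config G A) :
  cylinder x [seq p + q | q <- s] y -> cylinder (shift p x) s (shift p y).
Proof. by move=> xy q qs; apply: xy; exact: map_f. Qed.

(** The patterns of the pairs [(x1, x2)] and [(y1, y2)] occur in one point of the product; the
    difference of their positions is a [v] common to both coordinates. *)
Lemma mixing_cylinders s x1 x2 y1 y2 : X x1 -> X x2 -> X y1 -> X y2 ->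
  exists v z1 z2, [/\ X z1, cylinder x1 s z1 & cylinder y1 s (shift v z1)] /\
                  [/\ X z2, cylinder x2 s z2 & cylinder y2 s (shift v z2)].
Proof.
move=> Xx1 Xx2 Xy1 Xy2.
have valid_pattern u1 u2 : X u1 -> X u2 ->
    valid (prod_shift X X) (pattern (fun q => (u1 q, u2 q)) s).
  move=> Xu1 Xu2; exists (fun q => (u1 q, u2 q)) => //.
  by exists 0; apply/appears_pattern => q _; rewrite /shift add0r.
have [z [[Xz1 Xz2] [p /appears_pattern zp] [p' /appears_pattern zp']]] :=
  mixX (valid_pattern _ _ Xx1 Xx2) (valid_pattern _ _ Xy1 Xy2).
exists (p' - p), (shift p (fun q => (z q).1)), (shift p (fun q => (z q).2)).
rewrite !shiftD addrC subrK; split; split; try exact: shift_in.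
- by move=> q /zp /(congr1 fst).
- by move=> q /zp' /(congr1 fst).
- by move=> q /zp /(congr1 snd).
- by move=> q /zp' /(congr1 snd).
Qed.

(* Furstenberg's argument: write N(U, V) for the set of v such that
   [shift v @` U] meets [V]. Given open sets U, V, U', V', weak mixing yields some
   w in both N(U, U') and N(V, V'). Then N(U, V) and N(U', V') both contain
   N(U'', V''), where U'' (resp. V'') is the set of points of U (resp. V) that
   [shift w] sends into U' (resp. V'). *)
Lemma mixing_family x s (y : nat -> config G A) (t : nat -> seq G) m :
  X x -> (forall i, X (y i)) ->
  exists x' y' s', [/\ X x', X y' & forall v z,
    X z -> cylinder x' s' z -> cylinder y' s' (shift v z) ->
    forall i, (i < m)%N ->
    exists z', [/\ X z', cylinder x s z' & cylinder (y i) (t i) (shift v z')]].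
Proof.
move=> Xx Xy; elim: m => [|m [x' [y' [s' [Xx' Xy' IH]]]]].
  by exists x, x, [::]; split.
pose s1 := s' ++ s ++ t m.
have [w [x2 [y2 [[Xx2 x'x2 xx2] [Xy2 y'y2 yy2]]]]] :=
  mixing_cylinders s1 Xx' Xy' Xx (Xy m).
exists x2, y2, (s' ++ [seq w + q | q <- s ++ t m]); split=> // v z Xz.
move=> /cylinder_cat[x2z /shift_cylinder wx2z] /cylinder_cat[y2z].
move=> /shift_cylinder wy2z i; rewrite ltnS leq_eqVlt => /predU1P[->|im].
  (* Shifts commute, so [shift v] sends this point to [shift w (shift v z)], which is close to
     [y m]. *)
  exists (shift w z); split; first exact: shift_in.
    move=> q qs; rewrite wx2z ?mem_cat ?qs // xx2 //.
    by rewrite /s1 !mem_cat qs orbT.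
  move=> q qt; rewrite shiftD addrC -shiftD wy2z ?mem_cat ?qt ?orbT //.
  by rewrite yy2 // /s1 !mem_cat qt !orbT.
apply: (IH v z) im => //.
  by move=> q qs; rewrite x2z // x'x2 // /s1 mem_cat qs.
by move=> q qs; rewrite y2z // y'y2 // /s1 mem_cat qs.
Qed.

Lemma mixing_all x s (y : nat -> config G A) (t : nat -> seq G) m :
  X x -> (forall i, X (y i)) ->
  exists v, forall i, (i < m)%N ->
    exists z, [/\ X z, cylinder x s z & cylinder (y i) (t i) (shift v z)].
Proof.
move=> Xx Xy; have [x' [y' [s' [Xx' Xy' h]]]] := mixing_family s t m Xx Xy.
have [v [z [_ [[Xz x'z y'z] _]]]] := mixing_cylinders s' Xx' Xx' Xy' Xy'.
by exists v; exact: (h v z).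
Qed.

End WeakMixing.

(** * Narrow maps and the contradiction *)

Lemma card_le_seq (T : choiceType) (R : set T) r :
  (R #<= `I_r)%card -> exists2 s : seq T, (size s <= r)%N & forall i, R i -> i \in s.
Proof.
move=> Rr; have Rfin : finite_set R := card_le_finite Rr (finite_II r).
exists (fset_set R) => [|i Ri]; last by rewrite in_fset_set // inE.
have /finite_setP[k Rk] := Rfin.
by rewrite (card_fset_set Rk) -card_le_II -(card_le_eql Rk).
Qed.

Section ContinuousWithin.
Variables (E F : choiceType) (A B : finType) (X : set (config E A)).
Variable f : config E A -> config F B.
Hypothesis cf : {within X, continuous f}.

Lemma within_continuous_window i x : X x ->
  exists s, forall y, X y -> cylinder x s y -> f y i = f x i.
Proof.
move=> Xx; move/subspace_continuousP: cf => /(_ x Xx) /= fx.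
have /nbhs_cylinder[s sX] := fx _ (cylinder_nbhs (f x) [:: i]).
by exists s => y Xy /sX /(_ Xy i); apply; rewrite mem_head.
Qed.

End ContinuousWithin.

(** On the image of [g], [h] depends only on the cells in [w], and each of these reads at most [r]
    coordinates. *)
Lemma narrow_junta (F : countType) (A S : finType) r (g : config nat A -> config F S)
    (w : seq F) (h : config F S -> bool) : narrow r g ->
  (forall a a', (forall q, q \in w -> g a q = g a' q) -> h (g a) = h (g a')) ->
  exists2 s, (size s <= size w * r)%N & junta (fun a => h (g a)) s.
Proof.
move=> gr hw.
have /choice[t tP] : forall q, exists t : seq nat, (size t <= r)%N /\
    forall a a' : config nat A, (forall i, i \in t -> a i = a' i) -> g a q = g a' q.
  move=> q; have [R /card_le_seq[t tr Rt] gR] := gr q.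
  by exists t; split=> // a a' aa'; apply: gR => i /Rt /aa'.
exists (flatten [seq t q | q <- w]).
  elim: w {hw} => //= q w IH; rewrite size_cat mulSn leq_add //.
  by have [] := tP q.
move=> a a' aa'; apply: hw => q qw; have [_] := tP q; apply=> i iq.
by apply: aa'; apply/flatten_mapP; exists q.
Qed.

Theorem theorem6p1 (d : nat) (hd : (1 <= d)%N) (A : finType)
  (X : set (config 'rV[int]_d A)) (hX : is_subshift X)
  (hmix : weakly_mixing X) (hfac : weak_factor X Zbar) :
  ~ in_L1 X.
Proof.
have [_ shiftX] := hX; have [f [phi [cf fX fphi]]] := hfac.
move=> [compactX [B [r [F [FP XF]]]]].
have Zbar_lift z : Zbar z -> exists2 x, X x & f x = z by rewrite -fX => -[x]; exists x.
have [x0 Xx0 _] := Zbar_lift (fun=> true) (fun=> leqnn _).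
have closedF n : closed (range (F n)).
  apply: compact_closed; first exact: hausdorff_config.
  apply: continuous_compact; last exact: compact_config.
  by apply/continuous_subspaceT; have [] := FP n.
have [n [x [s [Xx xsF]]]] : exists n x s, X x /\ X `&` cylinder x s `<=` range (F n).
  by apply: compact_baire Xx0 closedF _ => //; rewrite XF.
have XFn a : X (F n a) by rewrite XF; exists n => //; exists a.
(* By equivariance every cell of [f y] is cell 0 of the image of a shifted point, so the single
   window [w] serves all cells. *)
have fE j y : X y -> f y j = f (shift (phi j) y) 0.
  by move=> Xy; rewrite -fphi // /shift addr0.
have [w wP] := uniform_window compactX (h := fun y => f y 0)
  (within_continuous_window cf 0).
(* [f y] is the point [-(j+1)] of [Zbar]: it steps from 0 to 1 between cells [j] and [j.+1]. *)
have /choice[y yP] : forall j : nat, exists y, X y /\ f y = (fun i => j%:Z < i)%R.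
  move=> j; have [|y Xy fy] := Zbar_lift (fun i => j%:Z < i)%R; last by exists y.
  by move=> i /=; lia.
have /choice[t tP] : forall j : nat, exists t, forall z, X z -> cylinder (y j) t z ->
    f z j%:Z = false /\ f z j.+1%:Z = true.
  move=> j; have [Xy fy] := yP j.
  have [t1 t1P] := within_continuous_window cf j%:Z Xy.
  have [t2 t2P] := within_continuous_window cf j.+1%:Z Xy.
  exists (t1 ++ t2) => z Xz /cylinder_cat[/t1P -> // /t2P -> //].
  by rewrite fy; split; lia.
(* This [m] is fixed before [v], so [v] can then be chosen to force [m.+1] jumps. *)
have [m mP] := @jumps_bounded nat (B n) (size w * r n).
have Xy j : X (y j) by have [] := yP j.
have [v vP] := mixing_all shiftX hmix s t m.+1 Xx Xy.
pose b (j : nat) a := f (shift v (F n a)) j%:Z.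
have Xv a : X (shift v (F n a)) by exact: shift_in.
suff : (m.+1 <= m)%N by rewrite ltnn.
have <- : jumps b m.+1 = m.+1.
  rewrite -[RHS]card_ord -sum1_card; apply: eq_bigr => j _.
  have [z [Xz xz yz]] := vP j (ltn_ord j).
  have [a _ Fa] := xsF z (conj Xz xz).
  have [bj bSj] := tP j _ (shift_in shiftX v Xz) yz.
  by rewrite asboolT //; exists a; rewrite /b Fa bj bSj.
apply: mP => [j a|j].
  have : Zbar (f (shift v (F n a))) by rewrite -fX; exists (shift v (F n a)).
  move=> /(_ j%:Z); rewrite /b (_ : j.+1%:Z = j%:Z + 1); last by rewrite -PoszD addn1.
  by case: (f (shift v (F n a)) j%:Z) => //=; rewrite lt0b.
(* After the shift by [v], cell [j] reads a translate of [w], whose size depends on neither [j] nor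
   [v]. *)
rewrite -(size_map (fun q => v + (phi j%:Z + q)) w).
have [_ Fr] := FP n.
apply: (narrow_junta (h := fun z => f (shift v z) j%:Z) Fr) => a a' aa'.
rewrite (fE _ _ (Xv a)) (fE _ _ (Xv a')); apply: (wP).
- exact: shift_in (Xv a).
- exact: shift_in (Xv a').
by move=> q qw; rewrite /shift aa' //; exact: map_f.
Qed.
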